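(* Let $S_0\colon\mathbb{R}^2\to\mathbb{R}$, $S_0(x_1,x_2):=x_1+x_2$, and let $U\subset\mathbb{R}^2$ be open. Fix $\epsilon>0$ and let $\mathbb{K}$ and $\mathbb{F}$ be two Cantor sets in $\mathbb{R}$, each one satisfying the $\epsilon$-stable gap condition, and such that $[\min\mathbb{K},\max\mathbb{K}]\times[\min\mathbb{F},\max\mathbb{F}]\subset U$. Assume that the pair $(\mathbb{K},\mathbb{F})$ satisfies the $\epsilon$-size condition. Then for any function $S\colon U\to\mathbb{R}$ such that $$\frac{1-\mathrm{Lip}(S-S_0|_U)}{1+\mathrm{Lip}(S-S_0|_U)}>1-\epsilon$$ we have $$S(\mathbb{K}\times\mathbb{F})=S\bigl([\min\mathbb{K},\max\mathbb{K}]\times[\min\mathbb{F},\max\mathbb{F}]\bigr).$$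
   Context: For a function $g\colon U\to\mathbb{R}$ with $U\subset\mathbb{R}^2$, $\mathrm{Lip}(g):=\sup_{z\ne w\in U}\frac{|g(z)-g(w)|}{|z-w|}$ with the Euclidean norm (assumed finite). $|I|$ denotes the length of an interval $I$. For a compact interval $K$ and an open interval $B\subset K$, let $K^L$ and $K^R$ be the closed subintervals of $K$ on the left and on the right of $B$ such that $K=K^L\sqcup B\sqcup K^R$. A slow subdivision of a Cantor set $\mathbb{K}\subset\mathbb{R}$ is a family of closed sets $(\mathbb{K}(n))_{n\in\mathbb{N}}$, $\mathbb{N}=\{0,1,2,\dots\}$, with $\mathbb{K}(n+1)\subset\mathbb{K}(n)$, such that: (1) $\mathbb{K}(n)$ is a union of $n+1$ disjoint closed intervals, with $\mathbb{K}(0)=[\min\mathbb{K},\max\mathbb{K}]$; (2) for any $n$ there is exactly one compact interval (component) $K$ of $\mathbb{K}(n)$ and a non-empty open subinterval $B_K\subset K$ such that $K\cap\mathbb{K}(n+1)=K\setminus B_K=K^L\sqcup K^R$, where $K^L,K^R$ are disjoint non-empty closed intervals of $\mathbb{K}(n+1)$ (so one passes from $\mathbb{K}(n)$ to $\mathbb{K}(n+1)$ by removing exactly one hole $B_K$); (3) $\bigcap_n\mathbb{K}(n)=\mathbb{K}$. The holes of $\mathbb{K}$ are the connected components of its complement contained in $[\min\mathbb{K},\max\mathbb{K}]$; the $B_K$ are exactly the holes, and the $n$-th hole is the one removed from $\mathbb{K}(n)$. A slow subdivision satisfies the $\epsilon$-stable gap condition if for any $n$ the $n$-th hole $B_K$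 satisfies $\frac{|B_K|}{|K^L|}<1-\epsilon$ and $\frac{|B_K|}{|K^R|}<1-\epsilon$. The Cantor set $\mathbb{K}$ satisfies the $\epsilon$-stable gap condition if it admits a slow subdivision which does. With $|\mathbb{K}|:=\max\mathbb{K}-\min\mathbb{K}$ and $|\mathbb{F}|:=\max\mathbb{F}-\min\mathbb{F}$, the pair $(\mathbb{K},\mathbb{F})$ satisfies the $\epsilon$-size condition if $|B|\le(1-\epsilon)|\mathbb{F}|$ and $|C|\le(1-\epsilon)|\mathbb{K}|$ for every hole $B$ of $\mathbb{K}$ and every hole $C$ of $\mathbb{F}$. *)

(* Defs.v *)
From mathcomp Require Import all_boot all_order all_algebra.
From mathcomp Require Import all_classical all_reals all_analysis.

Set Implicit Arguments.
Unset Strict Implicit.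
Unset Printing Implicit Defensive.

Import Order.TTheory GRing.Theory Num.Theory.
Import numFieldNormedType.Exports.

Local Open Scope classical_set_scope.
Local Open Scope ring_scope.

Section Definitions.
Variable R : realType.

Definition cantor_set (K : set R) : Prop :=
  [/\ K !=set0, compact K, perfect_set K & totally_disconnected K].

(* Only used for nonempty bounded sets. For a nonempty compact set, inf and sup
   are min and max; for a nondegenerate bounded interval, len is its length. *)
Definition hull (K : set R) : set R := `[inf K, sup K].

Definition len (A : set R) : R := sup A - inf A.

Definition is_component (A C : set R) : Prop :=
  exists2 x, A x & C = connected_component A x.

Definition hole (K B : set R) : Prop :=
  is_component (~` K) B /\ B `<=` hull K.

(* K is a compact interval, B a nonempty open subinterval, KL and KR the closed
   intervals (nonempty, possibly a single point) on the two sides of B in K. *)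
Definition split_interval (K B KL KR : set R) : Prop :=
  exists a b c d : R,
    [/\ a <= b, b < c, c <= d, K = `[a, d]%classic &
    [/\ B = `]b, c[%classic, KL = `[a, b]%classic & KR = `[c, d]%classic]].

(* One passes from A to A' by removing the single hole B from the component K
   of A, which leaves the components KL and KR of A'. *)
Definition hole_removed (A A' K B KL KR : set R) : Prop :=
  [/\ is_component A K, split_interval K B KL KR,
      K `&` A' = K `\` B /\ A' = A `\` B,
      is_component A' KL & is_component A' KR].

Definition disjoint_closed_intervals (m : nat) (A : set R) : Prop :=
  exists a b : nat -> R,
    [/\ forall i, (i < m)%N -> a i <= b i,
        trivIset `I_m (fun i => `[a i, b i]%classic) &
        A = \bigcup_(i in `I_m) `[a i, b i]%classic].

Definition slow_subdivision (K : set R) (Kn : nat -> set R) : Prop :=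
  [/\ (forall n, closed (Kn n)) /\ (forall n, Kn n.+1 `<=` Kn n),
      forall n, disjoint_closed_intervals n.+1 (Kn n),
      Kn 0%N = hull K,
      forall n, exists! C, exists B CL CR, hole_removed (Kn n) (Kn n.+1) C B CL CR &
      \bigcap_n Kn n = K].

(* When Kn is a slow subdivision of a Cantor set, CL and CR have positive
   length, since otherwise the Cantor set would have an isolated point. *)
Definition stable_gap_subdivision (eps : R) (Kn : nat -> set R) : Prop :=
  forall n C B CL CR, hole_removed (Kn n) (Kn n.+1) C B CL CR ->
    len B / len CL < 1 - eps /\ len B / len CR < 1 - eps.

Definition stable_gap (eps : R) (K : set R) : Prop :=
  exists Kn, slow_subdivision K Kn /\ stable_gap_subdivision eps Kn.

Definition size_condition (eps : R) (K F : set R) : Prop :=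
  (forall B, hole K B -> len B <= (1 - eps) * len F) /\
  (forall C, hole F C -> len C <= (1 - eps) * len K).

(* The library norm on R * R is the sup norm, not the Euclidean one. *)
Definition euclid_dist (z w : R * R) : R :=
  Num.sqrt ((z.1 - w.1) ^+ 2 + (z.2 - w.2) ^+ 2).

Definition lip_quotients (U : set (R * R)) (g : R * R -> R) : set R :=
  [set q | exists z w, [/\ U z, U w, z <> w & q = `|g z - g w| / euclid_dist z w]].

(* A function on U is represented by a total function of which only the values
   on U matter. *)
Definition lip_finite (U : set (R * R)) (g : R * R -> R) : Prop :=
  has_ubound (lip_quotients U g).

(* Meaningful under lip_finite only: sup is 0 on unbounded sets. *)
Definition Lip (U : set (R * R)) (g : R * R -> R) : R := sup (lip_quotients U g).

Definition S0 (z : R * R) : R := z.1 + z.2.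

End Definitions.

(* Main.v *)
Require Import Defs.
From mathcomp Require Import all_boot all_order all_algebra.
From mathcomp Require Import all_classical all_reals all_analysis.
From mathcomp Require Import ring lra.
Import Order.TTheory GRing.Theory Num.Theory.
Import numFieldNormedType.Exports.
Local Open Scope classical_set_scope.
Local Open Scope ring_scope.

Set Implicit Arguments.
Unset Strict Implicit.
Unset Printing Implicit Defensive.

(** Write [q = 1 - eps], [L] for the Lipschitz constant of [S - S0] and
    [kappa = (1 - L) / (1 + L)], so that [0 < q < kappa].  On the hull
    rectangle, [S] increases in each variable with slope between [1 - L] and
    [1 + L].  Let [I * J] be a rectangle with corners in [K * F].  Being
    monotone and continuous, [S] maps it onto the segment between the values at
    the lower left and upper right corners.  Deleting from [I] a hole [B] of [K]
    leaves two rectangles, and their image segments still cover that of [I * J]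
    as soon as [(1 + L) |B| <= (1 - L) |J|], that is [|B| <= kappa |J|]: going
    across [B] gains at most what climbing along [J] gains.  A value [t] of [S]
    on the hull rectangle can therefore be followed through smaller and smaller
    rectangles, down to a point of [K * F], provided that the holes in each side
    remain at most [kappa] times the other side ([linked], [linked_split]).

    The order of the slow subdivision cannot be followed, since it may remove a
    small hole before a large one while the comparison of sizes concerns all
    the holes of a side.  What the stable gap condition gives independently of
    the order is a form of thickness: of two holes [B], [B'] of the same Cantor
    set, the one removed later had a whole component piece between it and the
    other, so that one of [|B|], [|B'|] is less than [q] times their distance
    ([gap_far_apart]); in the same way [|B|] is less than [q] times the distance
    of [B] to the ends of the hull ([gap_far_ends]).  One may thus always
    delete the largest hole of the two sides: the pieces next to it are then
    longer than its length divided by [q], and hence than the length of any hole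
    of the other side divided by [q].

    To avoid arguing that a largest hole exists, one that is largest up to a
    factor [rho < 1] is deleted; the strict inequality [q < kappa] leaves room
    for [rho] with [q <= rho^2 kappa].  As long as a hole of length at least
    [del] is left, each deletion shortens the rectangle by at least [rho del],
    so that after finitely many steps all the holes of both sides are shorter
    than [del], and [t] is attained up to [4 del] on [K * F]
    ([linked_approx]).  Compactness of [S (K * F)] concludes. *)

(** * Closed sets of reals and their gaps *)

Section ClosedSets.
Context {R : realType}.
Implicit Types (A K : set R) (a b c d x : R).

Lemma closed_sup_mem A : closed A -> A !=set0 -> has_ubound A -> A (sup A).
Proof. by move=> Acl A0 ubA; apply/Acl/closure_sup. Qed.

Lemma closed_inf_mem A : closed A -> A !=set0 -> has_lbound A -> A (inf A).
Proof.
move=> Acl A0 lbA; apply: Acl => V /nbhs_ballP[e /= e0 eV].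
have [x Ax xlt] := inf_adherent e0 (conj A0 lbA).
exists x; split => //; apply: eV; rewrite /ball /= distrC ger0_norm ?subr_ge0.
  by rewrite ltrBlDl.
exact: ge_inf.
Qed.

Lemma compact_has_bounds A : compact A -> has_ubound A /\ has_lbound A.
Proof.
move=> /compact_bounded[M [_ /(_ (M + 1))]]; rewrite ltrDl => /(_ ltr01) MA.
by split; [exists (M + 1)|exists (- (M + 1))] => x /MA /=;
  rewrite ler_norml => /andP[].
Qed.

Lemma compact_closed_real A : compact A -> closed A.
Proof. by apply: compact_closed; exact: Rhausdorff. Qed.

Lemma compact_sup_mem A : compact A -> A !=set0 -> A (sup A).
Proof.
move=> Ac A0; apply: closed_sup_mem => //; first exact: compact_closed_real.
by have [] := compact_has_bounds Ac.
Qed.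

Lemma compact_inf_mem A : compact A -> A !=set0 -> A (inf A).
Proof.
move=> Ac A0; apply: closed_inf_mem => //; first exact: compact_closed_real.
by have [] := compact_has_bounds Ac.
Qed.

Lemma sub_hull A : compact A -> A `<=` hull A.
Proof.
move=> /compact_has_bounds[Aub Alb] x Ax.
by rewrite /hull /= in_itv /= ge_inf //= ub_le_sup.
Qed.

(** For compact [K] this makes [`]b, c[] a hole of [K] ([gap_hole]), without
    mentioning connected components. *)
Definition gap K b c :=
  [/\ b < c, K b, K c & forall x, b < x -> x < c -> ~ K x].

Lemma gap_around K a d x : closed K -> K a -> K d -> a <= x <= d -> ~ K x ->
  exists b c, [/\ gap K b c, a <= b, b < x, x < c & c <= d].
Proof.
move=> Kcl Ka Kd /andP[ax xd] nKx.
pose A := K `&` [set y | y <= x]; pose B := K `&` [set y | x <= y].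
have Aub : has_ubound A by exists x => y [].
have Blb : has_lbound B by exists x => y [].
have Aa : A a by []. have Bd : B d by [].
have [Ks sx] : A (sup A).
  by apply: closed_sup_mem => //; [apply: closedI => //; exact: closed_le|exists a].
have [Ki xi] : B (inf B).
  by apply: closed_inf_mem => //; [apply: closedI => //; exact: closed_ge|exists d].
have sx' : sup A < x.
  by rewrite lt_neqAle sx andbT; apply/eqP => E; apply: nKx; rewrite -E.
have xi' : x < inf B.
  by rewrite lt_neqAle xi andbT; apply/eqP => E; apply: nKx; rewrite E.
exists (sup A), (inf B); split => //; [|exact: ub_le_sup|exact: ge_inf].
split => //; first exact: lt_trans xi'.
move=> y sy yi Ky; have [yx|xy] := leP y x.
  by have := ub_le_sup Aub (conj Ky yx); rewrite leNgt sy.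
by have := ge_inf Blb (conj Ky (ltW xy)); rewrite leNgt yi.
Qed.

Lemma gap_eq K b c b' c' x : gap K b c -> gap K b' c' -> b < x -> x < c ->
  b' < x -> x < c' -> b = b' /\ c = c'.
Proof.
move=> [bc Kb Kc nK] [bc' Kb' Kc' nK'] bx xc bx' xc'; split; apply/eqP.
  rewrite eq_le; apply/andP; split; rewrite leNgt; apply/negP => lt.
    by apply: nK' Kb => //; exact: lt_trans xc'.
  by apply: nK Kb' => //; exact: lt_trans xc.
rewrite eq_le; apply/andP; split; rewrite leNgt; apply/negP => lt.
  by apply: nK Kc' => //; exact: lt_trans xc'.
by apply: nK' Kc => //; exact: lt_trans xc.
Qed.

Lemma itv_connected (i : interval R) : connected [set` i].
Proof. by apply/connected_intervalP; exact: interval_is_interval. Qed.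

Lemma len_cc a b : a <= b -> len `[a, b] = b - a.
Proof. by move=> ab; rewrite /len sup_itvcc ?inf_itvcc. Qed.

Lemma len_oo a b : a < b -> len `]a, b[ = b - a.
Proof. by move=> ab; rewrite /len sup_itv ?inf_itv ?bnd_simp. Qed.

Lemma gap_hole {K b c} : compact K -> gap K b c -> hole K `]b, c[.
Proof.
move=> Kc [bc Kb Kcc nK]; split; last first.
  move=> x /=; rewrite in_itv /= => /andP[bx xc].
  have := sub_hull Kc Kb; have := sub_hull Kc Kcc.
  rewrite /hull /= !in_itv /= => /andP[_ h1] /andP[h2 _].
  by rewrite (le_trans h2 (ltW bx)) (le_trans (ltW xc) h1).
have mid : b < (b + c) / 2 < c by rewrite !midf_lt.
have /andP[bm mc] := mid.
exists ((b + c) / 2); first exact: nK.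
apply/seteqP; split.
  apply: connected_component_max; last exact: itv_connected.
    by rewrite /= in_itv.
  by move=> x; rewrite /= in_itv /= => /andP[]; exact: nK.
move=> x [C [Cm CK /connected_intervalP Ci] Cx]; rewrite /= in_itv /=.
apply/andP; split; rewrite ltNge; apply/negP => le.
  by apply: (CK b) => //; apply: (Ci x _ Cx Cm); rewrite le ltW.
by apply: (CK c) => //; apply: (Ci _ x Cm Cx); rewrite le ltW.
Qed.

End ClosedSets.

(** * Thickness from the stable gap condition *)

Section Subdivision.
Context {R : realType}.
Implicit Types (A K : set R) (a b c d x p : R).

Lemma component_sub A C : is_component A C -> C `<=` A.
Proof. by move=> [x _ ->]; exact: connected_component_sub. Qed.

(** Among finitely many disjoint closed intervals, a point component is at
    positive distance from all the others, so that it would be isolated in [K].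
    This rules out the value [0] of a quotient by a zero length in the stable
    gap condition. *)
Lemma no_point_component A K m p : perfect_set K -> K `<=` A ->
  disjoint_closed_intervals m A -> K p -> ~ is_component A `[p, p].
Proof.
move=> [_ Kperf] KA [a [b [_ _ AE]]] Kp [x Ax Cx].
have px : p = x.
  have : (`[p, p]%classic : set R) x by rewrite Cx; exact: connected_component_refl.
  by rewrite /= in_itv /= => pxp; apply/eqP; rewrite eq_le.
have Cp : connected_component A p = `[p, p]%classic by rewrite Cx px.
pose far := [set i | (i < m)%N /\ ~ `[a i, b i]%classic p].
pose V := \bigcup_(i in far) `[a i, b i]%classic.
have Vcl : closed V.
  apply: closed_bigcup => [|i _]; last exact: itv_closed.
  by apply: (sub_finite_set (B := `I_m)) => [i []|] //; exact: finite_II.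
have Vp : nbhs p (~` V).
  by apply: open_nbhs_nbhs; split; [exact: closed_openC|move=> [i []]].
have : limit_point K p by rewrite Kperf.
move=> /(_ _ Vp)[y [yp Ky nVy]].
have /KA := Ky; rewrite AE => -[i im iy].
have ip : `[a i, b i]%classic p.
  by apply: contrapT => nip; apply: nVy; exists i.
have : connected_component A p y.
  apply: (connected_component_max ip) iy; last exact: itv_connected.
  by rewrite AE => z iz; exists i.
rewrite Cp /= in_itv /= => pyp.
by move/negP: yp; apply; rewrite eq_le andbC.
Qed.

Lemma avoid_left A a b c b' : `[a, b'] `<=` A ->
  (forall x, A x -> ~ `]b, c[%classic x) ->
  b < c -> c <= b' -> c <= a.
Proof.
move=> sA Abc bc cb'; rewrite leNgt; apply/negP => ac.
have mc : Num.max a b < c by rewrite gt_max ac bc.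
have /andP[h1 h2] : Num.max a b < (Num.max a b + c) / 2 < c by rewrite !midf_lt.
have := h1; rewrite gt_max => /andP[h3 h4].
apply: (Abc ((Num.max a b + c) / 2)).
  by apply: sA; rewrite /= in_itv /= (ltW h3) /= (le_trans (ltW h2)).
by rewrite /= in_itv /= h4 h2.
Qed.

Lemma avoid_right A c d b' c' : `[c, d] `<=` A ->
  (forall x, A x -> ~ `]b', c'[%classic x) ->
  b' < c' -> c <= b' -> d <= b'.
Proof.
move=> sA Abc bc cb'; rewrite leNgt; apply/negP => ac.
have mc : b' < Num.min d c' by rewrite lt_min ac bc.
have /andP[h1 h2] : b' < (b' + Num.min d c') / 2 < Num.min d c' by rewrite !midf_lt.
have := h2; rewrite lt_min => /andP[h3 h4].
apply: (Abc ((b' + Num.min d c') / 2)).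
  by apply: sA; rewrite /= in_itv /= (ltW h3) andbT (le_trans cb' (ltW h1)).
by rewrite /= in_itv /= h1 h4.
Qed.

Lemma slow_subdivision_anti K Kn m n : slow_subdivision K Kn -> (m <= n)%N ->
  Kn n `<=` Kn m.
Proof.
move=> [[_ Ks] _ _ _ _] /subnK <-; elim: (n - m)%N => [|k IH] //.
exact: subset_trans (Ks _) IH.
Qed.

(** A point removed at a later stage belongs to an open hole contained in a
    component, hence is interior to that stage and to all the earlier ones. The
    end points of the holes, which are not interior, therefore stay in [K]. *)
Lemma frontier_survives K Kn m x : slow_subdivision K Kn ->
  Kn m x -> ~ nbhs x (Kn m) -> K x.
Proof.
move=> sub Km nI; have [_ _ _ rem KE] := sub.
suff Kall k : (m <= k)%N -> Kn k x.
  rewrite -KE => k _; have [/Kall//|/ltnW km] := leqP m k.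
  exact: slow_subdivision_anti sub km _ Km.
elim: k => [|k IH]; first by rewrite leqn0 => /eqP m0; rewrite -m0.
rewrite leq_eqVlt => /predU1P[<-//|]; rewrite ltnS => mk.
have [C [[B [CL [CR [compC split [_ KkE] _ _]]]] _]] := rem k.
have [a [b [c [d [ab bc cd CE [BE _ _]]]]]] := split.
rewrite KkE; split; first exact: IH.
move=> Bx; apply: nI.
apply: (@filterS _ _ _ B).
  move=> y By; apply: (slow_subdivision_anti sub mk); apply: (component_sub compC).
  move: By; rewrite CE BE /= !in_itv /= => /andP[h1 h2].
  by rewrite (le_trans ab (ltW h1)) (le_trans (ltW h2) cd).
by apply: open_nbhs_nbhs; split => //; rewrite BE; exact: interval_open.
Qed.

Lemma not_nbhs_left_gap A b c : b < c -> (forall x, A x -> ~ `]b, c[%classic x) ->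
  ~ nbhs b A.
Proof.
move=> bc Abc /nbhs_ballP[e /= e0 eA].
pose y := b + Num.min (e / 2) ((c - b) / 2).
have m0 : 0 < Num.min (e / 2) ((c - b) / 2) by rewrite lt_min !divr_gt0 // subr_gt0.
have m1 : Num.min (e / 2) ((c - b) / 2) <= e / 2 by rewrite ge_min lexx.
have m2 : Num.min (e / 2) ((c - b) / 2) <= (c - b) / 2 by rewrite ge_min lexx orbT.
apply: (Abc y); last by rewrite /= in_itv /= /y; apply/andP; split; lra.
by apply: eA; rewrite /ball /= ltr_distl /y; apply/andP; split; lra.
Qed.

Lemma not_nbhs_right_gap A b c : b < c -> (forall x, A x -> ~ `]b, c[%classic x) ->
  ~ nbhs c A.
Proof.
move=> bc Abc /nbhs_ballP[e /= e0 eA].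
pose y := c - Num.min (e / 2) ((c - b) / 2).
have m0 : 0 < Num.min (e / 2) ((c - b) / 2) by rewrite lt_min !divr_gt0 // subr_gt0.
have m1 : Num.min (e / 2) ((c - b) / 2) <= e / 2 by rewrite ge_min lexx.
have m2 : Num.min (e / 2) ((c - b) / 2) <= (c - b) / 2 by rewrite ge_min lexx orbT.
apply: (Abc y); last by rewrite /= in_itv /= /y; apply/andP; split; lra.
by apply: eA; rewrite /ball /= ltr_distl /y; apply/andP; split; lra.
Qed.

Section Stages.
Variables (eps : R) (K : set R) (Kn : nat -> set R).
Hypotheses (hK : cantor_set K) (sub : slow_subdivision K Kn).
Hypothesis hgap : stable_gap_subdivision eps Kn.

Lemma cantor_sub_stage n : K `<=` Kn n.
Proof. by have [_ _ _ _ <-] := sub => x; apply. Qed.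

Definition removed_at n a b c d :=
  [/\ gap K b c, a < b /\ c < d, `[a, d] `<=` Kn n, Kn n.+1 = Kn n `\` `]b, c[ &
      c - b < (1 - eps) * (b - a) /\ c - b < (1 - eps) * (d - c)].

Lemma removal_stage n : exists a b c d, removed_at n a b c d.
Proof.
have [_ _ Kperf _] := hK; have [_ dci _ rem _] := sub.
have [C [[B [CL [CR hr]]] _]] := rem n.
have [lenL lenR] := hgap hr.
have [compC [a [b [c [d [ab bc cd CE [BE LE RE]]]]]] [_ KnE] compL compR] := hr.
rewrite {}LE {}RE {}BE {}CE {hr B C CL CR} in compC KnE compL compR lenL lenR.
have off x : Kn n.+1 x -> ~ `]b, c[%classic x by rewrite KnE => -[].
have Kb : K b.
  apply: (frontier_survives sub (m := n.+1)); last exact: not_nbhs_left_gap off.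
  by apply: (component_sub compL); rewrite /= in_itv /= ab lexx.
have Kc : K c.
  apply: (frontier_survives sub (m := n.+1)); last exact: not_nbhs_right_gap off.
  by apply: (component_sub compR); rewrite /= in_itv /= cd lexx.
have ab' : a < b.
  rewrite lt_neqAle ab andbT; apply/eqP => E; move: compL; rewrite E.
  exact: no_point_component Kperf (@cantor_sub_stage n.+1) (dci n.+1) Kb.
have cd' : c < d.
  rewrite lt_neqAle cd andbT; apply/eqP => E; move: compR; rewrite -E.
  exact: no_point_component Kperf (@cantor_sub_stage n.+1) (dci n.+1) Kc.
exists a, b, c, d; split => //.
- split => // x bx xc /(@cantor_sub_stage n.+1)/off; apply.
  by rewrite /= in_itv /= bx.
- exact: component_sub compC.
- by move: lenL lenR; rewrite len_oo // !len_cc // !ltr_pdivrMr ?subr_gt0.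
Qed.

Lemma gap_stage b c : gap K b c -> exists n a d, removed_at n a b c d.
Proof.
move=> g; have [bc Kb Kc nK] := g; have [_ _ K0 _ KE] := sub.
have [_ Kcpt _ _] := hK.
have /andP[bm mc] : b < (b + c) / 2 < c by rewrite !midf_lt.
set m := (b + c) / 2 in bm mc.
have [n [Knm Kn'm]] : exists n, Kn n m /\ ~ Kn n.+1 m.
  apply: contrapT => none; apply: (nK m bm mc); rewrite -KE => n _.
  elim: n => [|n IH]; last by apply: contrapT => ?; apply: none; exists n.
  rewrite K0; have := sub_hull Kcpt Kb; have := sub_hull Kcpt Kc.
  rewrite /hull /= !in_itv /= => /andP[_ h1] /andP[h2 _].
  by rewrite (le_trans h2 (ltW bm)) (le_trans (ltW mc) h1).
have [a [b' [c' [d r]]]] := removal_stage n.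
have [g' _ _ KnE _] := r.
have : `]b', c'[%classic m by apply: contrapT => ?; apply: Kn'm; rewrite KnE.
rewrite /= in_itv /= => /andP[bm' mc'].
have [-> ->] := gap_eq g g' bm mc bm' mc'.
by exists n, a, d.
Qed.

Lemma stable_gap_ratio_gt0 : 0 < 1 - eps.
Proof.
have [a [b [c [d [[bc _ _ _] [ab _] _ _ [lL _]]]]]] := removal_stage 0.
have : 0 < (1 - eps) * (b - a) by apply: lt_trans lL; rewrite subr_gt0.
by rewrite pmulr_lgt0 // subr_gt0.
Qed.

(** The hole removed later was cut from a component that avoids the other hole,
    so that the piece left between them is at most as long as their distance.
    The disjunction forgets the order of removal. *)
Lemma gap_far_apart b c b' c' : gap K b c -> gap K b' c' -> c <= b' ->
  c - b < (1 - eps) * (b' - c) \/ c' - b' < (1 - eps) * (b' - c).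
Proof.
move=> g g' cb'; have q0 := stable_gap_ratio_gt0.
have [bc _ _ _] := g; have [bc' _ _ _] := g'.
have [m [a [d [_ [ab cd] sC KmE [_ lR]]]]] := gap_stage g.
have [m' [a' [d' [_ [ab' cd'] sC' KmE' [lL' _]]]]] := gap_stage g'.
have off x : Kn m.+1 x -> ~ `]b, c[%classic x by rewrite KmE => -[].
have off' x : Kn m'.+1 x -> ~ `]b', c'[%classic x by rewrite KmE' => -[].
case: (ltngtP m m') => [mm'|m'm|E].
- right; apply: (lt_le_trans lL'); rewrite ler_pM2l // lerD2l lerN2.
  apply: (avoid_left (b := b) (A := Kn m.+1) (b' := b')) => //.
  move=> x /=; rewrite in_itv /= => /andP[a'x xb'].
  apply: (slow_subdivision_anti sub mm'); apply: sC'; rewrite /= in_itv /= a'x.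
  by rewrite (le_trans xb') // (le_trans (ltW bc')) // ltW.
- left; apply: (lt_le_trans lR); rewrite ler_pM2l // lerD2r.
  apply: (avoid_right (c' := c') (A := Kn m'.+1) (c := c)) => //.
  move=> x /=; rewrite in_itv /= => /andP[cx xd].
  apply: (slow_subdivision_anti sub m'm); apply: sC; rewrite /= in_itv /= xd.
  by rewrite (le_trans _ cx) // (le_trans (ltW ab)) // ltW.
- have /andP[bm mc] : b < (b + c) / 2 < c by rewrite !midf_lt.
  exfalso; apply: (off ((b + c) / 2)); last by rewrite /= in_itv /= bm mc.
  rewrite E KmE'; split.
    rewrite -E; apply: sC; rewrite /= in_itv /= (le_trans (ltW ab) (ltW bm)).
    by rewrite (le_trans (ltW mc) (ltW cd)).
  rewrite /= in_itv /= => /andP[b'm _].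
  by move: (lt_trans (le_lt_trans cb' b'm) mc); rewrite ltxx.
Qed.

Lemma gap_far_ends b c : gap K b c ->
  c - b < (1 - eps) * (b - inf K) /\ c - b < (1 - eps) * (sup K - c).
Proof.
move=> g; have [bc _ _ _] := g.
have [n [a [d [_ [ab cd] sC _ [lL lR]]]]] := gap_stage g.
have q0 := stable_gap_ratio_gt0; have [_ _ K0 _ _] := sub.
have in_hull x : a <= x <= d -> inf K <= x <= sup K.
  move=> axd; have : Kn 0%N x.
    by apply: (slow_subdivision_anti sub (leq0n n)); apply: sC; rewrite /= in_itv.
  by rewrite K0 /hull /= in_itv.
have ad : a <= d by rewrite ltW // (lt_trans ab) // (lt_trans bc).
have /andP[aK _] : inf K <= a <= sup K by apply: in_hull; rewrite lexx.
have /andP[_ dK] : inf K <= d <= sup K by apply: in_hull; rewrite lexx andbT.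
split; [apply: (lt_le_trans lL)|apply: (lt_le_trans lR)]; rewrite ler_pM2l //.
  by rewrite lerD2l lerN2.
by rewrite lerD2r.
Qed.

End Stages.
End Subdivision.

(** * Lipschitz functions with slopes close to one *)

Section Lipschitz.
Context {R : realType}.

Lemma lipschitz_within_continuous (V : normedModType R) (A : set V) (g : V -> R) k :
  (forall x y, A x -> A y -> `|g x - g y| <= k * `|x - y|) ->
  {within A, continuous g}.
Proof.
move=> lip; apply/subspace_continuousP => x Ax; apply/cvgrPdist_le => e e0.
have k0 : 0 < `|k| + 1 by rewrite ltr_wpDl.
have d0 : 0 < e / (`|k| + 1) by rewrite divr_gt0.
apply/(@nbhs_ballP _ V); exists (e / (`|k| + 1)) => //= z.
rewrite -ball_normE /ball_ /= => xz Az; apply: (le_trans (lip _ _ Ax Az)).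
move: xz; rewrite ltr_pdivlMr // => /ltW; apply: le_trans.
by rewrite mulrC ler_wpM2l // (le_trans (ler_norm k)) // lerDl.
Qed.

Definition steep lam (P Q : set R) (f : R -> R -> R) :=
  forall x x' y, P x -> P x' -> Q y -> x <= x' ->
    (1 - lam) * (x' - x) <= f x' y - f x y <= (1 + lam) * (x' - x).

Lemma steep_lip lam P Q f x x' y : lam <= 1 -> steep lam P Q f ->
  P x -> P x' -> Q y -> `|f x' y - f x y| <= 2 * `|x' - x|.
Proof.
move=> l1 fst.
wlog xx' : x x' / x <= x'.
  move=> H Px Px' Qy; have [xx'|/ltW x'x] := leP x x'; first exact: H.
  by rewrite distrC [X in 2 * X]distrC; exact: H.
move=> Px Px' Qy; have /andP[h1 h2] := fst _ _ _ Px Px' Qy xx'.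
have x0 : 0 <= x' - x by rewrite subr_ge0.
have l0 : 0 <= 1 - lam by rewrite subr_ge0.
rewrite ger0_norm; last by apply: le_trans h1; rewrite mulr_ge0.
rewrite ger0_norm //; apply: (le_trans h2).
by rewrite ler_wpM2r // -[2]/(1 + 1) lerD2l.
Qed.

Lemma steep_mono lam P Q f x x' y : lam <= 1 -> steep lam P Q f ->
  P x -> P x' -> Q y -> x <= x' -> f x y <= f x' y.
Proof.
move=> l1 fst Px Px' Qy xx'; have /andP[h1 _] := fst _ _ _ Px Px' Qy xx'.
by rewrite -subr_ge0; apply: le_trans h1; rewrite mulr_ge0 // subr_ge0.
Qed.

End Lipschitz.

(** * Following a value through linked rectangles *)

Section Linked.
Context {R : realType}.
Variables (q kappa rho lam : R).
Hypotheses (q0 : 0 < q) (rho0 : 0 < rho) (rho1 : rho < 1).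
Hypotheses (qrho : q <= rho ^+ 2 * kappa).
Hypotheses (lam0 : 0 <= lam) (lam1 : lam < 1).
Hypothesis kappaE : kappa * (1 + lam) = 1 - lam.

Definition spread (K : set R) :=
  forall b c b' c', gap K b c -> gap K b' c' -> c <= b' ->
  c - b < q * (b' - c) \/ c' - b' < q * (b' - c).

(** Thickness relative to [`[a, d]]. The factor [rho] is there because the holes
    that bound [`[a, d]] were chosen as largest up to that factor only. *)
Definition thick (K : set R) a d := forall b c, gap K b c -> a <= b -> c <= d ->
  rho * (c - b) <= q * (b - a) /\ rho * (c - b) <= q * (d - c).

Definition gaps_le (K : set R) a d s :=
  forall b c, gap K b c -> a <= b -> c <= d -> c - b <= s.

Definition side K a d s :=
  [/\ K a, K d, a <= d, thick K a d & gaps_le K a d (kappa * s)].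

(** When [f] is monotone and continuous, the last condition says that it takes
    the value [t] on [`[a, d] * `[a', d']]. *)
Definition linked K F (f : R -> R -> R) t a d a' d' :=
  [/\ side K a d (d' - a'), side F a' d' (d - a) & f a a' <= t <= f d d'].

Lemma kappa_gt0 : 0 < kappa.
Proof.
have : 0 < kappa * (1 + lam) by rewrite kappaE subr_gt0.
by rewrite pmulr_lgt0 // ltr_wpDr.
Qed.

(** By [spread], the distance from another gap to [`]b, c[] controls the length
    of one of the two; if it is that of [`]b, c[], then this length in turn
    bounds [rho] times the other one. *)
Lemma thick_left K a b c d : spread K -> gap K b c -> c <= d ->
  thick K a d ->
  (forall u v, gap K u v -> a <= u -> v <= d -> rho * (v - u) <= c - b) ->
  thick K a b.
Proof.
move=> sK g cd th big u v guv au vb; have [uv _ _ _] := guv; have [bc _ _ _] := g.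
have vd : v <= d by rewrite (le_trans vb) // (le_trans (ltW bc)).
have [h1 _] := th _ _ guv au vd; split => //.
have [h|h] := sK _ _ _ _ guv g vb; apply: le_trans (ltW h); last exact: big.
by rewrite ger_pMl ?subr_gt0 // ltW.
Qed.

Lemma thick_right K a b c d : spread K -> gap K b c -> a <= b ->
  thick K a d ->
  (forall u v, gap K u v -> a <= u -> v <= d -> rho * (v - u) <= c - b) ->
  thick K c d.
Proof.
move=> sK g ab th big u v guv cu vd; have [uv _ _ _] := guv; have [bc _ _ _] := g.
have au : a <= u by rewrite (le_trans ab) // (le_trans (ltW bc)).
have [_ h1] := th _ _ guv au vd; split => //.
have [h|h] := sK _ _ _ _ g guv cu; apply: le_trans (ltW h); first exact: big.
by rewrite ger_pMl ?subr_gt0 // ltW.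
Qed.

(** Here [B] is the length of the deleted hole, [s] that of a piece next to it
    and [C] that of a hole in the other side. Both losses of a factor [rho], in
    the choice of [B] and in [thick], are absorbed by [q <= rho ^+ 2 * kappa]. *)
Lemma size_transfer B C s :
  0 <= C -> rho * C <= B -> rho * B <= q * s -> C <= kappa * s.
Proof.
move=> C0 h1 h2; have k0 := kappa_gt0.
rewrite -(ler_pM2l q0); apply: (@le_trans _ _ (kappa * (q * s))); last first.
  by rewrite mulrCA.
apply: (@le_trans _ _ (kappa * (rho * (rho * C)))).
  apply: (le_trans (ler_wpM2r C0 qrho)); rewrite expr2 -!mulrA [kappa * _]mulrC.
  by rewrite [kappa * _]mulrC !mulrA.
by rewrite ler_pM2l //; apply: le_trans h2; rewrite ler_pM2l.
Qed.

(** Deleting an almost largest hole leaves at least one linked rectangle. The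
    images of the two rectangles overlap because [f c a' <= f b d'], which
    follows from [c - b <= kappa * (d' - a')]. *)
Lemma linked_split K F P Q f t a d a' d' b c :
  spread K -> steep lam P Q f -> steep lam Q P (fun y x => f x y) ->
  K `<=` P -> F `<=` Q ->
  linked K F f t a d a' d' -> gap K b c -> a <= b -> c <= d ->
  (forall u v, gap K u v -> a <= u -> v <= d -> rho * (v - u) <= c - b) ->
  (forall u v, gap F u v -> a' <= u -> v <= d' -> rho * (v - u) <= c - b) ->
  linked K F f t a b a' d' \/ linked K F f t c d a' d'.
Proof.
move=> sK fP fQ KP FQ [[Ka Kd ad th le] [Fa Fd ad' th' le'] /andP[t1 t2]].
move=> g ab cd bigK bigF.
have [bc Kb Kc _] := g.
have [thb thc] := th _ _ g ab cd.
have key : f c a' <= f b d'.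
  have /andP[_ h1] := fP _ _ _ (KP _ Kb) (KP _ Kc) (FQ _ Fa) (ltW bc).
  have /andP[h2 _] := fQ _ _ _ (FQ _ Fa) (FQ _ Fd) (KP _ Kb) ad'.
  have h3 : (1 + lam) * (c - b) <= (1 - lam) * (d' - a').
    rewrite -kappaE mulrAC [_ * (1 + lam)]mulrC ler_pM2l ?ltr_wpDr //.
    exact: le.
  by move: (le_trans h1 (le_trans h3 h2)); rewrite lerD2r.
have len0 u v : gap F u v -> 0 <= v - u by move=> [uv _ _ _]; rewrite subr_ge0 ltW.
have [tb|/ltW bt] := leP t (f b d'); [left|right]; split => //.
- split => //; first exact: thick_left th bigK.
  by move=> u v guv au vb; apply: le => //; rewrite (le_trans vb) // (le_trans (ltW bc)).
- split => // u v guv au vd.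
  by apply: (size_transfer (B := c - b)) (len0 _ _ guv) (bigF _ _ guv au vd) thb.
- by rewrite t1.
- split => //; first exact: thick_right th bigK.
  by move=> u v guv cu vd; apply: le => //; rewrite (le_trans ab) // (le_trans (ltW bc)).
- split => // u v guv au vd.
  by apply: (size_transfer (B := c - b)) (len0 _ _ guv) (bigF _ _ guv au vd) thc.
- by rewrite t2 (le_trans key).
Qed.

(** Exchanging the two variables makes [linked_split] serve for the holes of
    both sides. *)
Lemma linked_swap K F f t a d a' d' :
  linked K F f t a d a' d' -> linked F K (fun y x => f x y) t a' d' a d.
Proof. by move=> [? ? ?]; split. Qed.

Definition gap_lengths (K : set R) a d :=
  [set s | exists b c, [/\ gap K b c, a <= b, c <= d & s = c - b]].

(** The supremum need not be attained, but some element exceeds [rho] times it. *)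
Lemma almost_max (G : set R) s : has_ubound G -> G s -> 0 < s ->
  exists2 m, G m & rho * s <= m /\ forall r, G r -> rho * r <= m.
Proof.
move=> Gub Gs s0; have ss := ub_le_sup Gub Gs.
have e0 : 0 < (1 - rho) * sup G by rewrite mulr_gt0 ?subr_gt0 // (lt_le_trans s0).
have hs : has_sup G by split => //; exists s.
have [m Gm] := sup_adherent e0 hs.
rewrite mulrBl mul1r opprB addrC subrK => mm.
have H r : G r -> rho * r <= m.
  by move=> /(ub_le_sup Gub) rs; rewrite (le_trans _ (ltW mm)) // ler_pM2l.
by exists m => //; split => //; exact: H.
Qed.

Lemma near_mem K a d x del : closed K -> K a -> K d -> a <= x <= d -> 0 <= del ->
  gaps_le K a d del -> exists2 y, K y & `|y - x| <= del.
Proof.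
move=> Kcl Ka Kd axd del0 small; have [Kx|nKx] := pselect (K x).
  by exists x => //; rewrite subrr normr0.
have [b [c [g ab bx xc cd]]] := gap_around Kcl Ka Kd axd nKx.
have := small _ _ g ab cd; have [bc Kb _ _] := g; exists b => //.
by rewrite distrC ger0_norm ?subr_ge0 1?ltW // (lt_le_trans _ H) // ltrD2r.
Qed.

Section Approximation.
Variables (m M m' M' : R) (K F : set R) (f : R -> R -> R).
Let P : set R := `[m, M].
Let Q : set R := `[m', M'].
Hypotheses (Kcl : closed K) (Fcl : closed F) (KP : K `<=` P) (FQ : F `<=` Q).
Hypotheses (sK : spread K) (sF : spread F).
Hypotheses (fP : steep lam P Q f) (fQ : steep lam Q P (fun y x => f x y)).

Lemma steep_box_lipschitz x x' y y' : P x -> P x' -> Q y -> Q y' ->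
  `|f x' y' - f x y| <= 2 * `|x' - x| + 2 * `|y' - y|.
Proof.
move=> Px Px' Qy Qy'; rewrite (_ : _ - _ = (f x' y' - f x y') + (f x y' - f x y)).
  apply: (le_trans (ler_normD _ _)); apply: lerD.
    exact: steep_lip (ltW lam1) fP _ _ _.
  exact: steep_lip (ltW lam1) fQ _ _ _.
by rewrite addrA subrK.
Qed.

(** Along the diagonal of the rectangle, [f] is a Lipschitz function of one
    variable. *)
Lemma diagonal_IVT t a d a' d' : P a -> P d -> Q a' -> Q d' -> a <= d -> a' <= d' ->
  f a a' <= t <= f d d' ->
  exists x y, [/\ a <= x <= d, a' <= y <= d' & f x y = t].
Proof.
move=> Pa Pd Qa Qd ad ad' tt.
pose px s := a + s * (d - a); pose py s := a' + s * (d' - a').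
have inx s : 0 <= s <= 1 -> a <= px s <= d.
  by move=> /andP[s0 s1]; apply/andP; split; rewrite /px; nra.
have iny s : 0 <= s <= 1 -> a' <= py s <= d'.
  by move=> /andP[s0 s1]; apply/andP; split; rewrite /py; nra.
have Ppx s : 0 <= s <= 1 -> P (px s).
  move: Pa Pd; rewrite /P /= !in_itv /= => /andP[h1 _] /andP[_ h2] /inx/andP[h3 h4].
  by rewrite (le_trans h1) // (le_trans h4).
have Qpy s : 0 <= s <= 1 -> Q (py s).
  move: Qa Qd; rewrite /Q /= !in_itv /= => /andP[h1 _] /andP[_ h2] /iny/andP[h3 h4].
  by rewrite (le_trans h1) // (le_trans h4).
have gc : {within `[0 : R, 1], continuous (fun s => f (px s) (py s))}.
  apply: (@lipschitz_within_continuous _ R _ _ (2 * (d - a) + 2 * (d' - a'))) => s r /=.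
  rewrite !in_itv /= => s01 r01; apply: le_trans (steep_box_lipschitz _ _ _ _) _; rewrite /= ?in_itv /=.
  - exact: Ppx.
  - exact: Ppx.
  - exact: Qpy.
  - exact: Qpy.
  have -> : px s - px r = (s - r) * (d - a) by rewrite /px; ring.
  have -> : py s - py r = (s - r) * (d' - a') by rewrite /py; ring.
  rewrite !normrM (ger0_norm (_ : 0 <= d - a)) ?(ger0_norm (_ : 0 <= d' - a')) ?subr_ge0 //.
  by rewrite le_eqVlt; apply/orP; left; apply/eqP; ring.
have [|s s01 fs] := IVT (v := t) (@ler01 R) gc.
  rewrite /px /py !mul0r !addr0 !mul1r !subrKC.
  have /andP[t1 t2] := tt.
  by rewrite ge_min t1 le_max t2 orbT.
rewrite in_itv /= in s01.
by exists (px s), (py s); split; [exact: inx|exact: iny|].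
Qed.

Lemma linked_shrink del t a d a' d' s : 0 < del -> linked K F f t a d a' d' ->
  (gap_lengths K a d `|` gap_lengths F a' d') s -> del <= s ->
  exists a1 d1 a1' d1', linked K F f t a1 d1 a1' d1' /\
    (d1 - a1) + (d1' - a1') + rho * del <= (d - a) + (d' - a').
Proof.
move=> del0 lk Gs dels.
have [[_ _ ad _ _] [_ _ ad' _ _] _] := lk.
have Gub : has_ubound (gap_lengths K a d `|` gap_lengths F a' d').
  exists (d - a + (d' - a')) => r [] [b [c [_ h1 h2 ->]]]; lra.
have [l Gl [ls lmax]] := almost_max Gub Gs (lt_le_trans del0 dels).
have dl : rho * del <= l by apply: le_trans ls; rewrite ler_pM2l.
have bigK u v : gap K u v -> a <= u -> v <= d -> rho * (v - u) <= l.
  by move=> g au vd; apply: lmax; left; exists u, v.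
have bigF u v : gap F u v -> a' <= u -> v <= d' -> rho * (v - u) <= l.
  by move=> g au vd; apply: lmax; right; exists u, v.
case: Gl => -[b [c [g ab cd lE]]]; rewrite {}lE in dl bigK bigF.
  have [lk'|lk'] := linked_split sK fP fQ KP FQ lk g ab cd bigK bigF.
    by exists a, b, a', d'; split => //; lra.
  by exists c, d, a', d'; split => //; lra.
have [lk'|lk'] := linked_split sF fQ fP FQ KP (linked_swap lk) g ab cd bigF bigK.
  by exists a, d, a', b; split; [exact: linked_swap lk'|lra].
by exists a, d, c, d'; split; [exact: linked_swap lk'|lra].
Qed.

(** The rectangle contains a solution of [f x y = t]; when all the gaps are
    short, its coordinates are close to [K] and [F]. *)
Lemma linked_no_gap del t a d a' d' : 0 <= del -> linked K F f t a d a' d' ->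
  gaps_le K a d del -> gaps_le F a' d' del ->
  exists x y, [/\ K x, F y & `|f x y - t| <= 4 * del].
Proof.
move=> del0 [[Ka Kd ad _ _] [Fa Fd ad' _ _] tt] gK gF.
have [x [y [axd ayd <-]]] :=
  diagonal_IVT (KP Ka) (KP Kd) (FQ Fa) (FQ Fd) ad ad' tt.
have [x1 Kx1 xx1] := near_mem Kcl Ka Kd axd del0 gK.
have [y1 Fy1 yy1] := near_mem Fcl Fa Fd ayd del0 gF.
exists x1, y1; split => //; apply: le_trans (steep_box_lipschitz _ _ _ _) _.
- have := KP Ka; have := KP Kd; rewrite /P /= !in_itv /=.
  case/andP: axd => ax xd /andP[_ dM] /andP[ma _].
  by rewrite (le_trans ma) // (le_trans xd).
- exact: KP.
- have := FQ Fa; have := FQ Fd; rewrite /Q /= !in_itv /=.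
  case/andP: ayd => ax xd /andP[_ dM] /andP[ma _].
  by rewrite (le_trans ma) // (le_trans xd).
- exact: FQ.
by lra.
Qed.

(** A step of [linked_shrink] shortens the half-perimeter by at least
    [rho * del]; this can happen only finitely many times. *)
Lemma linked_approx del t a d a' d' : 0 < del -> linked K F f t a d a' d' ->
  exists x y, [/\ K x, F y & `|f x y - t| <= 4 * del].
Proof.
move=> del0; have rd0 : 0 < rho * del by rewrite mulr_gt0.
have step a1 d1 a1' d1' : linked K F f t a1 d1 a1' d1' ->
    (exists x y, [/\ K x, F y & `|f x y - t| <= 4 * del]) \/
    exists a2 d2 a2' d2', linked K F f t a2 d2 a2' d2' /\
      (d2 - a2) + (d2' - a2') + rho * del <= (d1 - a1) + (d1' - a1').
  move=> lk; have [[s [Gs dels]]|none] := pselect (exists s,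
    (gap_lengths K a1 d1 `|` gap_lengths F a1' d1') s /\ del <= s).
    by right; exact: linked_shrink lk Gs dels.
  by left; apply: (linked_no_gap (ltW del0) lk) => b c g h1 h2;
    rewrite leNgt; apply/negP => lt; apply: none; exists (c - b); rewrite (ltW lt);
    split => //; [left|right]; exists b, c.
suff ind n a1 d1 a1' d1' : d1 - a1 + (d1' - a1') <= n%:R * (rho * del) ->
    linked K F f t a1 d1 a1' d1' ->
    exists x y, [/\ K x, F y & `|f x y - t| <= 4 * del].
  move=> lk; apply: (ind (Num.bound ((d - a + (d' - a')) / (rho * del)))) (lk).
  have [[_ _ ad _ _] [_ _ ad' _ _] _] := lk.
  rewrite -ler_pdivrMr // ltW // archi_boundP //.
  by rewrite divr_ge0 ?(ltW rd0) // addr_ge0 ?subr_ge0.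
elim: n a1 d1 a1' d1' => [|n IH] a1 d1 a1' d1' small /step[//|].
  move=> [a2 [d2 [a2' [d2' [[[_ _ h1 _ _] [_ _ h2 _ _] _] le2]]]]].
  by exfalso; move: small; rewrite mul0r; lra.
move=> [a2 [d2 [a2' [d2' [lk2 le2]]]]].
by apply: IH lk2; move: small; rewrite -natr1 mulrDl mul1r; lra.
Qed.

Lemma linked_attained t a d a' d' : compact K -> compact F ->
  linked K F f t a d a' d' -> exists x y, [/\ K x, F y & f x y = t].
Proof.
move=> Kc Fc lk; pose g (z : R * R) := f z.1 z.2.
have gc : {within K `*` F, continuous g}.
  apply: (@lipschitz_within_continuous _ (R * R)%type _ _ 4) => z w [Kz Fz] [Kw Fw].
  apply: (le_trans (steep_box_lipschitz (KP Kw) (KP Kz) (FQ Fw) (FQ Fz))).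
  have h1 : `|z.1 - w.1| <= `|z - w| by rewrite prod_normE le_max lexx.
  have h2 : `|z.2 - w.2| <= `|z - w| by rewrite prod_normE le_max lexx orbT.
  by lra.
have : (g @` (K `*` F)) t.
  apply: (compact_closed_real (continuous_compact gc (compact_setX Kc Fc))).
  move=> V /nbhs_ballP[e /= e0 eV].
  (* The approximation with [del = e / 8] is within [e / 2] of [t]. *)
  have [x [y [Kx Fy xyt]]] := linked_approx (divr_gt0 e0 (ltr0Sn R 7)) lk.
  exists (f x y); split; first by exists (x, y).
  by apply: eV; rewrite /ball /= distrC; lra.
by move=> [[x y] [/= Kx Fy] <-]; exists x, y.
Qed.

End Approximation.
End Linked.

(** * From the hypotheses to a linked pair *)

Section Hypotheses.
Context {R : realType}.

Lemma Lip_ge0 (U : set (R * R)) g : 0 <= Lip U g.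
Proof.
rewrite /Lip; have [->|/set0P[r Ur]] := eqVneq (lip_quotients U g) set0.
  by rewrite sup0.
have [ub|nub] := pselect (has_ubound (lip_quotients U g)); last first.
  by rewrite sup_out // => -[].
apply: le_trans (ub_le_sup ub Ur); have [z [w [_ _ _ ->]]] := Ur.
by rewrite divr_ge0 // sqrtr_ge0.
Qed.

Lemma euclid_dist_eq0 (z w : R * R) : (euclid_dist z w == 0) = (z == w).
Proof.
rewrite sqrtr_eq0 le_eqVlt ltNge addr_ge0 ?sqr_ge0 //= orbF paddr_eq0 ?sqr_ge0 //.
by rewrite !sqrf_eq0 !subr_eq0; case: z w => [z1 z2] [w1 w2].
Qed.

Lemma Lip_le (U : set (R * R)) g z w : lip_finite U g -> U z -> U w ->
  `|g z - g w| <= Lip U g * euclid_dist z w.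
Proof.
move=> fin Uz Uw; have [->|zw] := eqVneq z w.
  by rewrite subrr normr0 mulr_ge0 ?Lip_ge0 // sqrtr_ge0.
have d0 : 0 < euclid_dist z w.
  by rewrite lt_neqAle sqrtr_ge0 eq_sym euclid_dist_eq0 zw.
by rewrite -ler_pdivrMr //; apply: ub_le_sup => //; exists z, w; split => //; exact/eqP.
Qed.

Lemma steep_perturbation (U : set (R * R)) (P Q : set R) (S : R * R -> R)
    (L := Lip U (fun z => S z - S0 z)) :
  lip_finite U (fun z => S z - S0 z) -> P `*` Q `<=` U ->
  steep L P Q (fun x y => S (x, y)) /\ steep L Q P (fun y x => S (x, y)).
Proof.
move=> fin PQU; split=> x x' y Px Px' Qy xx'.
  have := Lip_le fin (PQU (x', y) (conj Px' Qy)) (PQU (x, y) (conj Px Qy)).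
  rewrite -/L /euclid_dist /S0 /= subrr expr0n addr0 sqrtr_sqr.
  by rewrite [in X in _ <= X]ger0_norm ?subr_ge0 // ler_norml => /andP[? ?]; lra.
have := Lip_le fin (PQU (y, x') (conj Qy Px')) (PQU (y, x) (conj Qy Px)).
rewrite -/L /euclid_dist /S0 /= subrr expr0n add0r sqrtr_sqr.
by rewrite [in X in _ <= X]ger0_norm ?subr_ge0 // ler_norml => /andP[? ?]; lra.
Qed.

Lemma stable_gap_gt0 eps (K : set R) :
  cantor_set K -> stable_gap eps K -> 0 < 1 - eps.
Proof. by move=> cK [Kn [sub gp]]; exact: stable_gap_ratio_gt0 cK sub gp. Qed.

Lemma stable_gap_spread eps (K : set R) : cantor_set K -> stable_gap eps K ->
  spread (1 - eps) K.
Proof. by move=> cK [Kn [sub gp]] b c b' c'; exact: (gap_far_apart cK sub gp). Qed.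

Lemma stable_gap_thick eps rho (K : set R) : cantor_set K -> stable_gap eps K ->
  rho <= 1 -> thick (1 - eps) rho K (inf K) (sup K).
Proof.
move=> cK [Kn [sub gp]] r1 b c g _ _; have [bc _ _ _] := g.
have [h1 h2] := gap_far_ends cK sub gp g.
by split; apply: le_trans (ltW _); try eassumption; rewrite ger_pMl // subr_gt0.
Qed.

Lemma gaps_le_holes (K : set R) s : compact K ->
  (forall B, hole K B -> len B <= s) -> gaps_le K (inf K) (sup K) s.
Proof.
move=> Kc h b c g _ _; have [bc _ _ _] := g.
by have := h _ (gap_hole Kc g); rewrite len_oo.
Qed.

End Hypotheses.

Unset Implicit Arguments.

Theorem theorem1p12 (R : realType) (U : set (R * R)) (hU : open U)
    (eps : R) (heps : 0 < eps) (K F : set R)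
    (hK : cantor_set K) (hF : cantor_set F)
    (hKgap : stable_gap eps K) (hFgap : stable_gap eps F)
    (hKFU : hull K `*` hull F `<=` U)
    (hsize : size_condition eps K F)
    (S : R * R -> R)
    (hfin : lip_finite U (fun z => S z - S0 z))
    (hLip : 1 - eps < (1 - Lip U (fun z => S z - S0 z))
                      / (1 + Lip U (fun z => S z - S0 z))) :
  S @` (K `*` F) = S @` (hull K `*` hull F).
Proof.
have [K0 Kc _ _] := hK; have [F0 Fc _ _] := hF.
apply/seteqP; split.
  by apply: image_subset => -[x y] [/= Kx Fy]; split; exact: sub_hull.
move=> _ [[x y] [/= hx hy] <-].
have [fP fQ] := steep_perturbation hfin hKFU.
have := Lip_ge0 U (fun z => S z - S0 z).
move: hLip fP fQ; set L := Lip U _ => hLip fP fQ L0.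
have L1 : 0 < 1 + L by rewrite ltr_wpDr.
have q0 := stable_gap_gt0 hK hKgap.
set kappa := (1 - L) / (1 + L) in hLip.
have k0 : 0 < kappa := lt_trans q0 hLip.
have kE : kappa * (1 + L) = 1 - L by rewrite /kappa divfK // gt_eqF.
have Llt1 : L < 1 by rewrite -subr_gt0 -kE mulr_gt0.
(* By the inequality of the means, [rho ^+ 2 >= (1 - eps) / kappa]. *)
pose rho := (1 + (1 - eps) / kappa) / 2.
have r0 : 0 < (1 - eps) / kappa by rewrite divr_gt0.
have r1 : (1 - eps) / kappa < 1 by rewrite ltr_pdivrMr // mul1r.
have rho0 : 0 < rho by rewrite /rho; lra.
have rho1 : rho < 1 by rewrite /rho; lra.
have qrho : 1 - eps <= rho ^+ 2 * kappa.
  by rewrite -ler_pdivrMr // /rho; nra.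
have KP := sub_hull Kc; have FQ := sub_hull Fc.
have iK := compact_inf_mem Kc K0; have sK := compact_sup_mem Kc K0.
have iF := compact_inf_mem Fc F0; have sF := compact_sup_mem Fc F0.
have [hs1 hs2] := hsize.
have isK : inf K <= sup K by have [_ Klb] := compact_has_bounds Kc; exact: ge_inf.
have isF : inf F <= sup F by have [_ Flb] := compact_has_bounds Fc; exact: ge_inf.
have sz (A B : set R) : compact A -> inf B <= sup B ->
    (forall C, hole A C -> len C <= (1 - eps) * len B) ->
    gaps_le A (inf A) (sup A) (kappa * (sup B - inf B)).
  move=> Ac isB hAB; apply: gaps_le_holes => // C /hAB /le_trans; apply.
  by rewrite ler_wpM2r ?subr_ge0 // ltW.
have lk : linked (1 - eps) kappa rho K F (fun x y => S (x, y)) (S (x, y))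
    (inf K) (sup K) (inf F) (sup F).
  have hx' := hx; have hy' := hy.
  move: hx hy; rewrite /hull /= !in_itv /= => /andP[ix xs] /andP[iy ys].
  split; first by split => //; [exact: stable_gap_thick (ltW rho1)|exact: sz].
    by split => //; [exact: stable_gap_thick (ltW rho1)|exact: sz].
  apply/andP; split.
    apply: le_trans (steep_mono (ltW Llt1) fP (KP _ iK) hx' (FQ _ iF) ix) _.
    exact: steep_mono (ltW Llt1) fQ (FQ _ iF) hy' hx' iy.
  apply: le_trans (steep_mono (ltW Llt1) fP hx' (KP _ sK) hy' xs) _.
  exact: steep_mono (ltW Llt1) fQ hy' (FQ _ sF) (KP _ sK) ys.
have [x1 [y1 [Kx Fy <-]]] := linked_attained q0 rho0 rho1 qrho L0 Llt1 kE
  (compact_closed_real Kc) (compact_closed_real Fc) KP FQ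
  (stable_gap_spread hK hKgap) (stable_gap_spread hF hFgap) fP fQ Kc Fc lk.
by exists (x1, y1).
Qed.
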